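(* For $k\ge2$ and $1\le h\le\log k$, $$k\le\widehat{S}(\mathrm{TEP},h)\le\frac{2^{2^{h-1}+1}}{3}\cdot k.$$ In particular, $\widehat{S}(\mathrm{TEP},\log\log k)\le k^2/3$.
   Context: Logarithms base 2. Tree Evaluation Problem: $(\mathrm{TEP},1):[k]\to[k]$ is the identity; for $h\ge2$, $(\mathrm{TEP},h):[k]^{n_h}\to[k]$, $n_h=(2^{h-1}-1)k^2+2^{h-1}$, takes as input a complete binary tree of height $h$ (a root with two leaves has height 2) whose leaves carry values in $[k]$ and whose internal nodes carry matrices in $[k]^{k\times k}$ (each entry an input variable); a leaf's value is its label, an internal node with matrix $M$ has value $M(a,b)$ where $a,b$ are its children's values, and the output is the root's value. For $f:[k]^N\to R$ and $A\subseteq[N]$, $f_A$ is the $k^{|A|}\times k^{N-|A|}$ matrix with rows indexed by $\alpha\in[k]^A$, columns by assignments to the complement, entry the value of $f$; $\mathsf{mult}(f_A)$ is the number of occurrences of a most frequent row. $\widehat{S}(f)=\max_{1\le\ell\le N}\min_{A\subseteq[N],|A|=\ell}k^{\ell}/\mathsf{mult}(f_A)$. *)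

(* Defs.v *)
From HB Require Import structures.
From mathcomp Require Import all_boot all_order all_algebra zify.

Set Implicit Arguments.
Unset Strict Implicit.
Unset Printing Implicit Defensive.

Import Order.TTheory GRing.Theory Num.Theory.

Local Open Scope ring_scope.

(* Functions f : [k]^N -> R are represented as f : {ffun I -> 'I_k} -> R,
   where I is a finite type of N = #|I| variables. *)

Section Shat.

Variables (k : nat) (I : finType) (R : eqType).

Definition glue (A : {set I}) (a : {ffun {i : I | i \in A} -> 'I_k})
    (b : {ffun {i : I | i \notin A} -> 'I_k}) : {ffun I -> 'I_k} :=
  [ffun i => match boolP (i \in A) with
             | AltTrue iA => a (exist _ i iA)
             | AltFalse iNA => b (exist _ i iNA)
             end].

(* The row of the matrix f_A indexed by a. *)
Definition frow (f : {ffun I -> 'I_k} -> R) (A : {set I})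
    (a : {ffun {i : I | i \in A} -> 'I_k}) :
    {ffun {ffun {i : I | i \notin A} -> 'I_k} -> R} :=
  [ffun b => f (glue a b)].

Definition mult (f : {ffun I -> 'I_k} -> R) (A : {set I}) : nat :=
  \max_(a : {ffun {i : I | i \in A} -> 'I_k})
     #|[set a' : {ffun {i : I | i \in A} -> 'I_k} | frow f a' == frow f a]|.

(* For k > 0 one has 1 <= mult f A, so every term of the inner minimum lies in
   ]0, k ^ l]. The default values k ^ l and 0 are thus neutral, and the minimum
   and the maximum range over nonempty families when 0 < #|I|. *)
Definition Shat (f : {ffun I -> 'I_k} -> R) : rat :=
  \big[Num.max/0]_(1 <= l < #|I|.+1)
    \big[Num.min/(k ^ l)%:R]_(A : {set I} | #|A| == l)
      ((k ^ l)%:R / (mult f A)%:R).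

End Shat.

(* Input variables of a complete binary tree with d + 1 levels: those of the
   left subtree, those of the right subtree, and the k ^ 2 entries of the
   matrix at the root. *)
Fixpoint tep_var (k d : nat) : finType :=
  if d is d'.+1 then (tep_var k d' + tep_var k d' + 'I_k * 'I_k)%type
  else unit.

Fixpoint tree_value (k d : nat) : {ffun tep_var k d -> 'I_k} -> 'I_k :=
  match d return {ffun tep_var k d -> 'I_k} -> 'I_k with
  | 0%N => fun x => x tt
  | d'.+1 => fun x =>
      x (inr (@tree_value k d' [ffun v => x (inl (inl v))],
              @tree_value k d' [ffun v => x (inl (inr v))]))
  end.

(* A tree of height h has h levels; only h >= 1 is meaningful. *)
Definition TEP (k h : nat) : {ffun tep_var k h.-1 -> 'I_k} -> 'I_k :=
  @tree_value k h.-1.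

Lemma card_tep_var (k h : nat) : (1 <= h)%N ->
  #|tep_var k h.-1| = ((2 ^ h.-1 - 1) * k ^ 2 + 2 ^ h.-1)%N.
Proof.
case: h => // d _ /=; elim: d => [|d IHd] /=; first by rewrite card_unit.
rewrite !card_sum card_prod card_ord IHd (expnS 2).
have : (0 < 2 ^ d)%N by rewrite expn_gt0.
case: (2 ^ d)%N => // m _.
by rewrite -mulnn !subn1; lia.
Qed.

(* Main.v *)
(* A lower bound on mult f A comes from a set T of total assignments that all
   restrict to the same row of f_A: then k ^ #|A| / mult f A <= k ^ N / #|T|.

   Lower bound on Shat: reading all variables, each row class has k ^ (N - 1)
   elements, since every value of TEP is taken equally often.

   Upper bound: with n = 2 ^ (h - 1) - 1 internal nodes, every size l admits an A
   of that size for which k ^ N / #|T| <= 2 ^ n * k.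
   - If l is at most the size of the left subtree, A is given by induction.
   - Up to k ^ 2 - k more variables, A consists of the left subtree and of root
     matrix entries outside row 0, and T fixes the value of the left child to 0.
   - For larger l, A contains all leaves and a set H of at least half of the
     positions of every matrix, which is possible as 2 ^ h <= k. In T, all n
     lookups hit H and the output is 0, a fraction (#|H| / k ^ 2) ^ n / k of all
     assignments. *)

Require Import Defs.
From mathcomp Require Import all_boot all_order all_algebra zify.

Import Order.TTheory GRing.Theory Num.Theory.
Local Open Scope nat_scope.

Set Implicit Arguments.
Unset Strict Implicit.

(** * Auxiliary facts on finite sets and dependent matching *)

Lemma set_between (I : finType) (B C : {set I}) l :
    B \subset C -> #|B| <= l <= #|C| ->
  exists A : {set I}, [/\ B \subset A, A \subset C & #|A| = l].
Proof.
move=> sBC /andP[leB leC]; have [m def_l] : exists m, l = #|B| + m.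
  by exists (l - #|B|); rewrite subnKC.
rewrite {}def_l in leC *; clear leB.
elim: m leC => [|m IHm] leC; first by exists B; rewrite addn0 subxx.
have [|A [sBA sAC cardA]] := IHm; first by apply: leq_trans leC; rewrite leq_add2l.
have /subsetPn[i iC iA] : ~~ (C \subset A).
  by apply: contraL leC => /subset_leq_card; rewrite cardA; lia.
exists (i |: A); split.
- exact: subset_trans sBA (subsetUr _ _).
- by rewrite subUset sub1set iC.
- by rewrite cardsU1 iA cardA; lia.
Qed.

(** Keeping the index [c] apart from [b] permits case analysis on [s] although [F] and [G] have
    types that mention [b]. *)
Lemma alt_specT (b c : bool) (s : alt_spec b b c) (T : Type) (F : b -> T)
    (G : ~~ b -> T) (b_true : b) : c ->
  match s with AltTrue p => F p | AltFalse q => G q end = F b_true.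
Proof. by case: c / s => // p _; rewrite (bool_irrelevance p b_true). Qed.

Lemma alt_specF (b c : bool) (s : alt_spec b b c) (T : Type) (F : b -> T)
    (G : ~~ b -> T) (b_false : ~~ b) : c = false ->
  match s with AltTrue p => F p | AltFalse q => G q end = G b_false.
Proof. by case: c / s => // q _; rewrite (bool_irrelevance q b_false). Qed.

(** * Row classes and general bounds on [Shat] *)

Section Restriction.

Variables (k : nat) (I : finType) (R : eqType).
Implicit Types (A : {set I}) (x z : {ffun I -> 'I_k}) (f : {ffun I -> 'I_k} -> R).

Definition restrict A x : {ffun {i : I | i \in A} -> 'I_k} :=
  [ffun i => x (val i)].

Definition corestrict A x : {ffun {i : I | i \notin A} -> 'I_k} :=
  [ffun i => x (val i)].

Definition override A x z : {ffun I -> 'I_k} :=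
  [ffun i => if i \in A then x i else z i].

Lemma glueT A (a : {ffun {i : I | i \in A} -> 'I_k}) b i (iA : i \in A) :
  glue a b i = a (exist _ i iA).
Proof. by rewrite ffunE; apply: alt_specT. Qed.

Lemma glueF A (a : {ffun {i : I | i \in A} -> 'I_k}) b i (iA : i \notin A) :
  glue a b i = b (exist _ i iA).
Proof. by rewrite ffunE; apply: alt_specF; apply: negbTE. Qed.

Lemma override_glue A x a b : override A x (glue a b) = glue (restrict A x) b.
Proof.
apply/ffunP=> i; rewrite ffunE; have [iA|iA] := boolP (i \in A).
  by rewrite glueT ffunE.
by rewrite !glueF.
Qed.

Lemma glue_inj A b : injective (fun a => @glue k I A a b).
Proof.
move=> a a' eq_g; apply/ffunP=> -[i iA].
by have := congr1 (fun x : {ffun I -> 'I_k} => x i) eq_g; rewrite /= !glueT.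
Qed.

Lemma restrict_inj A : injective (fun x => (restrict A x, corestrict A x)).
Proof.
move=> x y [/ffunP eqA /ffunP eqNA]; apply/ffunP=> i.
have [iA|iA] := boolP (i \in A).
  by have := eqA (exist _ i iA); rewrite !ffunE.
by have := eqNA (exist _ i iA); rewrite !ffunE.
Qed.

(* A set of total assignments whose restrictions to A all index the same row of
   f_A. *)
Definition same_row f A (T : {set {ffun I -> 'I_k}}) : Prop :=
  forall x y z, x \in T -> y \in T -> f (override A x z) = f (override A y z).

(** Restricting to [A] and to its complement embeds [T] in the product of one row class with all
    assignments of the complement. *)
Lemma card_same_row f A T : same_row f A T ->
  #|T| <= mult f A * k ^ (#|I| - #|A|).
Proof.
move=> Trow; have [->|[x0 x0T]] := set_0Vmem T; first by rewrite cards0.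
have /(leq_trans _) -> // :
    #|[set a' | frow f a' == frow f (restrict A x0)]| * k ^ (#|I| - #|A|)
    <= mult f A * k ^ (#|I| - #|A|).
  rewrite leq_mul2r; apply/orP; right.
  by rewrite /mult (bigD1 (restrict A x0)) //= leq_maxl.
have -> : k ^ (#|I| - #|A|) =
    #|[set: {ffun {i : I | i \notin A} -> 'I_k}]|.
  rewrite cardsT card_ffun card_ord card_sig; congr (_ ^ _).
  by rewrite -(cardsC A) addKn; apply: eq_card => i; rewrite !inE.
rewrite -cardsX -(card_imset _ (@restrict_inj A)).
apply/subset_leq_card/subsetP => _ /imsetP[x xT ->].
rewrite !inE andbT; apply/eqP/ffunP => b; rewrite !ffunE.
(* Both entries are written as overrides of the same [z], the assignment
   [glue (restrict A x0) b]. *)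
rewrite -[in LHS](override_glue _ (restrict A x0)).
by rewrite -[in RHS](override_glue _ (restrict A x0)); apply: Trow.
Qed.

Lemma mult_gt0 f A : 0 < k -> 0 < mult f A.
Proof.
move=> k_gt0; pose a0 : {ffun {i : I | i \in A} -> 'I_k} := [ffun=> Ordinal k_gt0].
rewrite /mult (bigD1 a0) //= leq_max; apply/orP; left.
by apply/card_gt0P; exists a0; rewrite inE.
Qed.

(** Equal rows agree in the column [b0], so gluing with [b0] embeds a row class in a fiber of
    [f]. *)
Lemma mult_le f A m : 0 < k -> (forall c, #|[set x | f x == c]| <= m) ->
  mult f A <= m.
Proof.
move=> k_gt0 fib; apply/bigmax_leqP => a _.
pose b0 : {ffun {i : I | i \notin A} -> 'I_k} := [ffun=> Ordinal k_gt0].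
rewrite -(card_imset _ (@glue_inj A b0)).
apply: leq_trans (fib (f (glue a b0))); apply/subset_leq_card/subsetP => x.
case/imsetP=> a'; rewrite !inE => /eqP eq_r ->.
by have /ffunP/(_ b0) := eq_r; rewrite !ffunE => ->.
Qed.

Local Open Scope ring_scope.

Lemma Shat_ub f (C : nat) : (0 < k)%N ->
    (forall l, (l <= #|I|)%N -> exists A T,
       [/\ #|A| = l, same_row f A T & (k ^ #|I| <= C * #|T|)%N]) ->
  Shat f <= C%:R.
Proof.
move=> k_gt0 cover; rewrite /Shat big_seq; apply: bigmax_le => // l.
rewrite mem_index_iota ltnS => /andP[_ leN].
have [A [T [cardA Trow leT]]] := cover l leN.
apply: (bigmin_inf A); first exact/eqP.
rewrite ler_pdivrMr ?ltr0n ?mult_gt0 // -natrM ler_nat.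
have := card_same_row Trow; rewrite cardA => leTm.
(* Scaling by the number of columns turns the goal into a comparison of [k ^ #|I|] with
   [C * #|T|]. *)
rewrite -(leq_pmul2r (m := k ^ (#|I| - l))) ?expn_gt0 ?k_gt0 //.
by rewrite -expnD subnKC // -mulnA (leq_trans leT) // leq_mul2l leTm orbT.
Qed.

Lemma Shat_lb f : (0 < k)%N -> (0 < #|I|)%N ->
    (forall c, #|[set x | f x == c]| <= k ^ #|I|.-1)%N ->
  k%:R <= Shat f.
Proof.
move=> k_gt0 I_gt0 fib.
rewrite /Shat; apply: le_trans (le_bigmax_seq _ #|I| _ _ _ _) => //; last first.
  by rewrite mem_index_iota I_gt0 ltnSn.
have expI : (k ^ #|I| = k * k ^ #|I|.-1)%N by rewrite -expnS prednK.
(* The default value [k ^ #|I|] of the minimum must be bounded below too; this uses [0 < #|I|]. *)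
apply: le_bigmin => [|A _].
  by rewrite ler_nat expI leq_pmulr // expn_gt0 k_gt0.
rewrite ler_pdivlMr ?ltr0n ?mult_gt0 // -natrM ler_nat expI leq_mul2l.
by rewrite mult_le ?orbT.
Qed.

End Restriction.


(** * Splitting an input into two subtrees and a root matrix *)

Section Tree.

Variable k : nat.
Hypothesis k_gt0 : 0 < k.
Implicit Type H : {set 'I_k * 'I_k}.

Local Notation input d := {ffun tep_var k d -> 'I_k}.
Local Notation matrix := {ffun 'I_k * 'I_k -> 'I_k}.
Local Notation value := (@tree_value k _).

Definition lsub d (x : input d.+1) : input d := [ffun v => x (inl (inl v))].
Definition rsub d (x : input d.+1) : input d := [ffun v => x (inl (inr v))].
Definition root_matrix d (x : input d.+1) : matrix := [ffun p => x (inr p)].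

Definition node d (u : input d * input d * matrix) : input d.+1 :=
  [ffun v : tep_var k d + tep_var k d + 'I_k * 'I_k =>
     match v with
     | inl (inl w) => u.1.1 w
     | inl (inr w) => u.1.2 w
     | inr p => u.2 p
     end].

Definition node_set d (A B : {set tep_var k d}) (E : {set 'I_k * 'I_k}) :
    {set tep_var k d.+1} :=
  [set v : tep_var k d + tep_var k d + 'I_k * 'I_k |
     match v with
     | inl (inl w) => w \in A
     | inl (inr w) => w \in B
     | inr p => p \in E
     end].

Lemma tree_valueS d (x : input d.+1) :
  value x = root_matrix x (value (lsub x), value (rsub x)).
Proof. by rewrite ffunE. Qed.

Lemma lsub_node d (u : input d * input d * matrix) : lsub (node u) = u.1.1.
Proof. by apply/ffunP=> v; rewrite !ffunE. Qed.

Lemma rsub_node d (u : input d * input d * matrix) : rsub (node u) = u.1.2.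
Proof. by apply/ffunP=> v; rewrite !ffunE. Qed.

Lemma root_matrix_node d (u : input d * input d * matrix) :
  root_matrix (node u) = u.2.
Proof. by apply/ffunP=> v; rewrite !ffunE. Qed.

Lemma node_bij d : bijective (@node d).
Proof.
exists (fun x => (lsub x, rsub x, root_matrix x)) => [[[l r] m]|x].
  by rewrite lsub_node rsub_node root_matrix_node.
by apply/ffunP=> -[[v|v]|p]; rewrite !ffunE.
Qed.

Lemma card_node_preim d (P : pred (input d.+1)) :
  #|[set x | P x]| = #|[set u | P (@node d u)]|.
Proof.
rewrite -(on_card_preimset (onW_bij _ (@node_bij d))).
by apply: eq_card => u; rewrite !inE.
Qed.

Lemma card_node_set d (A B : {set tep_var k d}) E :
  #|node_set A B E| = #|A| + #|B| + #|E|.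
Proof.
rewrite -sum1_card big_sumType big_sumType /= -!sum1_card.
by congr (_ + _ + _); apply: eq_bigl => i; rewrite inE.
Qed.

Lemma card_tep_varS d : #|tep_var k d.+1| = 2 * #|tep_var k d| + k ^ 2.
Proof. by rewrite /= !card_sum card_prod card_ord mul2n addnn. Qed.

Lemma lsub_override d A (x z : input d.+1) :
  lsub (override A x z) =
  override [set v | inl (inl v) \in A] (lsub x) (lsub z).
Proof. by apply/ffunP=> v; rewrite !ffunE inE. Qed.

Lemma rsub_override d A (x z : input d.+1) :
  rsub (override A x z) =
  override [set v | inl (inr v) \in A] (rsub x) (rsub z).
Proof. by apply/ffunP=> v; rewrite !ffunE inE. Qed.

Lemma card_ffun_fiber (T : finType) (t : T) (c : 'I_k) :
  #|[set m : {ffun T -> 'I_k} | m t == c]| = k ^ (#|T| - 1).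
Proof.
pose F i : pred 'I_k := if i == t then pred1 c else predT.
transitivity #|family F|.
  apply: eq_card => m; rewrite !inE; apply/eqP/familyP => [mt i|/(_ t)].
    by rewrite /F; case: eqP => [->|//]; rewrite inE mt.
  by rewrite /F eqxx inE => /eqP.
rewrite card_family foldrE big_map big_enum /= (bigD1 t) //=.
rewrite {1}/F eqxx card1 mul1n (eq_bigr (fun=> k)) => [|i /negPf neq].
  rewrite prod_nat_const; congr (_ ^ _).
  by rewrite subn1 -(cardC1 t); apply: eq_card.
by rewrite /F neq card_ord.
Qed.

Lemma card_lsub_preim d (P : pred (input d)) :
  #|[set x : input d.+1 | P (lsub x)]| =
  #|[set l | P l]| * k ^ (#|tep_var k d| + k ^ 2).
Proof.
rewrite card_node_preim.
transitivity #|setX (setX [set l | P l] [set: input d]) [set: matrix]|.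
  by apply: eq_card => u; rewrite !inE lsub_node !andbT.
rewrite !cardsX !cardsT !card_ffun card_prod !card_ord.
by rewrite -mulnA -expnD.
Qed.

(** * Counting inputs by their lookups and their value *)

(* Every matrix entry looked up while evaluating x has its position in H. *)
Fixpoint lookups_in H d : pred (input d) :=
  match d with
  | 0 => fun=> true
  | d'.+1 => fun x =>
      [&& @lookups_in H d' (lsub x), @lookups_in H d' (rsub x) &
          (value (lsub x), value (rsub x)) \in H]
  end.

(** Partition by the pair [(a, b)] in [H] of the children's values. By induction the counts for the
    subtrees do not depend on [a] and [b], and the root matrix has one entry fixed and [k ^ 2 - 1]
    free ones. *)
Lemma card_lookups_in H d c :
  #|[set x : input d | lookups_in H x && (value x == c)]| =
  #|H| ^ (2 ^ d - 1) * k ^ ((2 ^ d - 1) * (k ^ 2 - 1)).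
Proof.
elim: d c => [|d IHd] c.
  rewrite subnn /= mul1n expn0 -(cards1 ([ffun=> c] : input 0)); apply: eq_card => x.
  rewrite !inE; apply/eqP/eqP => [<-|->]; last by rewrite ffunE.
  by apply/ffunP=> -[]; rewrite ffunE.
rewrite card_node_preim -sum1dep_card.
rewrite (partition_big
  (fun u : input d * input d * matrix => (value u.1.1, value u.1.2))
  (mem H)); last first.
  by move=> u /=; rewrite lsub_node rsub_node => /andP[/and3P[]].
set n := 2 ^ d - 1 in IHd *.
have def_n : 2 ^ d.+1 - 1 = n + n.+1.
  by have := expn_gt0 2 d; rewrite expnS /n; lia.
rewrite (eq_bigr (fun=> (#|H| ^ n * k ^ (n * (k ^ 2 - 1))) ^ 2 * k ^ (k ^ 2 - 1))).
  rewrite sum_nat_const def_n; set q := k ^ 2 - 1.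
  have -> : (n + n.+1) * q = n * q + n * q + q by rewrite mulnDl mulSn; lia.
  rewrite -mulnn addnS [_ ^ (n + n).+1]expnS !expnD.
  by rewrite mulnACA !mulnA.
move=> [a b] abH; rewrite sum1dep_card.
transitivity #|setX (setX [set l : input d | lookups_in H l && (value l == a)]
                          [set r : input d | lookups_in H r && (value r == b)])
                    [set m : matrix | m (a, b) == c]|.
  apply: eq_card => -[[l r] m].
  rewrite !inE tree_valueS [lookups_in _ _]/=.
  rewrite lsub_node rsub_node root_matrix_node xpair_eqE /=.
  apply/idP/idP.
    case/andP=> /andP[/and3P[-> -> _] mc] /andP[/eqP va /eqP vb].
    by rewrite va vb in mc *; rewrite !eqxx.
  case/andP=> /andP[/andP[-> /eqP->] /andP[-> /eqP->]] ->.
  by rewrite (abH : (a, b) \in H) !eqxx.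
rewrite !cardsX !IHd card_ffun_fiber card_prod card_ord mulnn.
by rewrite -mulnn.
Qed.

Lemma lookups_in_setT d (x : input d) : lookups_in setT x.
Proof. by elim: d x => //= d IHd x; rewrite !IHd inE. Qed.

Lemma card_tep_varE d : #|tep_var k d| = (2 ^ d - 1) * k ^ 2 + 2 ^ d.
Proof. exact: (@card_tep_var k d.+1). Qed.

(** This is the count above for [H = setT]: with n internal nodes, 2n + n(k^2 - 1) = nk^2 + n is one
    less than the number of variables. *)
Lemma card_tree_value d c :
  #|[set x : input d | value x == c]| = k ^ #|tep_var k d|.-1.
Proof.
rewrite card_tep_varE.
transitivity #|[set x : input d | lookups_in setT x && (value x == c)]|.
  by apply: eq_card => x; rewrite !inE lookups_in_setT.
rewrite card_lookups_in cardsT card_prod card_ord mulnn -expnM -expnD.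
congr (_ ^ _); have := expn_gt0 2 d; have : 0 < k ^ 2 by rewrite expn_gt0 k_gt0.
set a := 2 ^ d; set b := k ^ 2; nia.
Qed.

Fixpoint read_set H d : {set tep_var k d} :=
  match d with
  | 0 => setT
  | d'.+1 => node_set (read_set H d') (read_set H d') H
  end.

Lemma card_read_set H d : #|read_set H d| = (2 ^ d - 1) * #|H| + 2 ^ d.
Proof.
elim: d => [|d IHd] /=; first by rewrite cardsT card_unit.
rewrite card_node_set IHd expnS.
have : 0 < 2 ^ d by rewrite expn_gt0.
by move: #|H| (2 ^ d) => h [|a] // _; rewrite !subn1 /=; nia.
Qed.

(** By induction the children's values are unchanged, so the root looks up the same position, which
    lies in [H] and hence is still taken from [x]. *)
Lemma tree_value_override H d (A : {set tep_var k d}) (x z : input d) :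
  read_set H d \subset A -> lookups_in H x -> value (override A x z) = value x.
Proof.
elim: d A x z => [|d IHd] A x z /subsetP sA.
  by move=> _; rewrite /= ffunE sA.
case/and3P=> hl hr hH.
rewrite !tree_valueS lsub_override rsub_override !IHd //.
- by rewrite !ffunE sA //= inE.
- by apply/subsetP=> v vR; rewrite inE sA //= inE.
- by apply/subsetP=> v vR; rewrite inE sA //= inE.
Qed.

(** * Sets [A] of every size, and the upper bound by induction on the tree *)

Definition coverable d (C : nat) : Prop :=
  forall l, l <= #|tep_var k d| -> exists (A : {set tep_var k d}) (T : {set input d}),
    [/\ #|A| = l, same_row (@tree_value k d) A T
      & k ^ #|tep_var k d| <= C * #|T|].

Lemma coverable0 : coverable 0 k.
Proof.
move=> l leN.
have [|A [_ _ cardA]] := @set_between _ set0 [set: tep_var k 0] l (sub0set _).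
  by rewrite cards0 cardsT.
(* There is a single variable, so [T] consists of one assignment and any [A] works. *)
exists A, [set x | value x == Ordinal k_gt0]; split=> //.
  by move=> x y z; rewrite !inE /= !ffunE => /eqP-> /eqP->.
by rewrite card_tree_value -expnS prednK // card_unit.
Qed.

(** The root matrix and the right subtree come from [z], so only the left child's value could
    differ. Pulling [T] back along [lsub] preserves its density, hence [C]. *)
Lemma cover_left d l C : coverable d C -> l <= #|tep_var k d| ->
  exists (A : {set tep_var k d.+1}) (T : {set input d.+1}),
    [/\ #|A| = l, same_row (@tree_value k d.+1) A T
      & k ^ #|tep_var k d.+1| <= C * #|T|].
Proof.
move=> cov /cov[A [T [cardA Trow leT]]].
exists (node_set A set0 set0), [set x | lsub x \in T]; split.
- by rewrite card_node_set cardA !cards0 !addn0.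
- move=> x y z; rewrite !inE => xT yT.
  rewrite !tree_valueS !lsub_override !rsub_override.
  have -> : [set v | inl (inl v) \in node_set A set0 set0] = A.
    by apply/setP=> v; rewrite !inE.
  have -> : [set v | inl (inr v) \in node_set A set0 set0] = set0.
    by apply/setP=> v; rewrite !inE.
  rewrite (Trow _ _ _ xT yT) !ffunE !inE; congr (z (inr (_, value _))).
  by apply/ffunP=> v; rewrite !ffunE !inE.
- rewrite card_lsub_preim card_tep_varS mul2n -addnn -addnA expnD mulnA.
  rewrite leq_mul2r; apply/orP; right.
  apply: leq_trans leT _; rewrite leq_mul2l; apply/orP; right.
  by apply/subset_leq_card/subsetP=> x; rewrite inE.
Qed.

(** On [T] the root looks up an entry in row [a0], which [A] avoids, and the right subtree is
    outside [A] as well; the output thus depends on [z] alone. [T] has density 1/k. *)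
Lemma cover_left_and_root d l :
    #|tep_var k d| <= l <= #|tep_var k d| + (k ^ 2 - k) ->
  exists (A : {set tep_var k d.+1}) (T : {set input d.+1}),
    [/\ #|A| = l, same_row (@tree_value k d.+1) A T
      & k ^ #|tep_var k d.+1| <= k * #|T|].
Proof.
move=> bnd_l; pose a0 := Ordinal k_gt0.
pose E : {set 'I_k * 'I_k} := setX [set~ a0] setT.
have [||A [sA /subsetP As cardA]] :=
  @set_between _ (@node_set d setT set0 set0) (node_set setT set0 E) l.
- by apply/subsetP=> -[[v|v]|p]; rewrite !inE.
- rewrite !card_node_set !cards0 cardsX cardsC1 !cardsT card_ord !addn0.
  by rewrite mulnC -subn1 mulnBr muln1 mulnn.
move/subsetP in sA.
exists A, [set x | value (lsub x) == a0]; split=> //.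
- move=> x y z; rewrite !inE => /eqP xa /eqP ya.
  rewrite !tree_valueS !lsub_override !rsub_override.
  have -> : [set v | inl (inl v) \in A] = setT.
    by apply/setP=> v; rewrite !inE sA // inE.
  have overT (w w' : input d) : override setT w w' = w.
    by apply/ffunP=> v; rewrite !ffunE inE.
  have noR : [set v | inl (inr v) \in A] = set0.
    by apply/setP=> v; rewrite !inE; apply/negP=> /As; rewrite !inE.
  have over0 (w w' : input d) : override set0 w w' = w'.
    by apply/ffunP=> v; rewrite !ffunE inE.
  rewrite noR !overT !over0 xa ya !ffunE.
  by case: ifP => // /As; rewrite !inE => /andP[/eqP].
- have -> : #|[set x : input d.+1 | value (lsub x) == a0]| =
      #|[set x : input d | value x == a0]| * k ^ (#|tep_var k d| + k ^ 2).
    exact: card_lsub_preim.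
  rewrite card_tree_value.
  rewrite mulnA -expnS prednK -?expnD; last first.
    by rewrite card_tep_varE addn_gt0 expn_gt0 orbT.
  by rewrite card_tep_varS mul2n -addnn -addnA.
Qed.

Lemma cover_half d l H : k ^ 2 <= 2 * #|H| ->
    (2 ^ d - 1) * #|H| + 2 ^ d <= l <= #|tep_var k d| ->
  exists (A : {set tep_var k d}) (T : {set input d}),
    [/\ #|A| = l, same_row (@tree_value k d) A T
      & k ^ #|tep_var k d| <= 2 ^ (2 ^ d - 1) * k * #|T|].
Proof.
move=> halfH bnd_l; pose c0 := Ordinal k_gt0.
have [||A [sA _ cardA]] := @set_between _ (read_set H d) setT l.
- exact: subsetT.
- by rewrite card_read_set cardsT.
exists A, [set x | lookups_in H x && (value x == c0)]; split=> //.
  move=> x y z; rewrite !inE => /andP[hx /eqP vx] /andP[hy /eqP vy].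
  by rewrite !(tree_value_override _ sA) // vx vy.
rewrite card_lookups_in card_tep_varE; set n := 2 ^ d - 1.
have -> : 2 ^ d = n.+1 by rewrite /n -subSn ?expn_gt0 // subn1.
(* The factor k^(2n) is set against [#|H| ^ n], at a cost of 2 per internal node; the remaining
   factor k accounts for the fixed output. *)
have -> : n * k ^ 2 + n.+1 = (2 * n + n * (k ^ 2 - 1)).+1.
  by have : 0 < k ^ 2 by [rewrite expn_gt0 k_gt0]; nia.
have le_n : (k ^ 2) ^ n <= 2 ^ n * #|H| ^ n.
  by rewrite -expnMn; case: n => // m; rewrite leq_exp2r.
rewrite expnS expnD expnM [2 ^ n * k]mulnC -(mulnA k) leq_mul2l mulnA leq_mul2r.
by rewrite le_n !orbT.
Qed.

Lemma coverable_step d C : 2 ^ d.+2 <= k -> C <= 2 ^ (2 ^ d.+1 - 1) * k ->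
  coverable d C -> coverable d.+1 (2 ^ (2 ^ d.+1 - 1) * k).
Proof.
move=> le_k leC cov l leN.
have [leNd|gtNd] := leqP l #|tep_var k d|.
  have [A [T [cardA Trow leT]]] := cover_left cov leNd.
  by exists A, T; split=> //; apply: leq_trans leT _; rewrite leq_mul2r leC orbT.
have [le_root|gt_root] := leqP l (#|tep_var k d| + (k ^ 2 - k)).
  have [|A [T [cardA Trow leT]]] := @cover_left_and_root d l.
    by rewrite (ltnW gtNd).
  exists A, T; split=> //; apply: leq_trans leT _.
  by rewrite leq_mul2r leq_pmull ?orbT // expn_gt0.
have [||H [_ _ cardH]] := @set_between _ set0 [set: 'I_k * 'I_k] (uphalf (k ^ 2)).
- exact: sub0set.
- by rewrite cards0 cardsT card_prod card_ord mulnn; lia.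
apply: (@cover_half _ _ H); rewrite ?cardH; first by lia.
rewrite leN andbT; apply: leq_trans (ltnW gt_root).
(* The size of [read_set H d.+1] must not exceed the range of the previous case. With p = 2^d it
   suffices that 4p <= (k - 1)^2, which follows from 4p <= k. *)
have : 2 * uphalf (k ^ 2) <= k ^ 2 + 1 by lia.
rewrite card_tep_varE !expnS in le_k *; move: le_k.
have : 0 < 2 ^ d by rewrite expn_gt0.
rewrite expn0 muln1; move: (uphalf _) (2 ^ d) => h p.
clear - k_gt0; nia.
Qed.

Lemma coverable_tree d : 2 ^ d.+1 <= k -> coverable d (2 ^ (2 ^ d - 1) * k).
Proof.
elim: d => [|d IHd] le_k; first by rewrite mul1n; apply: coverable0.
have le_d : 2 ^ d.+1 <= k by apply: leq_trans le_k; rewrite leq_exp2l.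
apply: coverable_step (IHd le_d) => //.
by rewrite leq_mul2r leq_exp2l // leq_sub2r ?orbT // leq_exp2l.
Qed.

End Tree.

(** * Translation to heights and logarithms *)

Unset Implicit Arguments.

Local Open Scope ring_scope.

(* trunc_log 2 k is the floor of the base-2 logarithm of k, and
   trunc_log 2 (trunc_log 2 k) is the floor of log (log k), which is at least 1
   exactly when 4 <= k. *)
Theorem theorem4p3 (k : nat) (k_ge2 : (2 <= k)%N) :
  (forall h : nat, (1 <= h)%N -> (h <= trunc_log 2 k)%N ->
     k%:R <= Shat (@TEP k h)
     /\ Shat (@TEP k h) <= 2 ^+ (2 ^ (h - 1) + 1) / 3 * k%:R)
  /\ ((4 <= k)%N ->
      Shat (@TEP k (trunc_log 2 (trunc_log 2 k))) <= k%:R ^+ 2 / 3).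
Proof.
have k_gt0 : (0 < k)%N by apply: leq_trans k_ge2.
have bounds h : (1 <= h)%N -> (h <= trunc_log 2 k)%N ->
     k%:R <= Shat (@TEP k h)
     /\ Shat (@TEP k h) <= 2 ^+ (2 ^ (h - 1) + 1) / 3 * k%:R.
  case: h => // d _ le_log; rewrite subSS subn0; split.
    apply: Shat_lb => // [|c]; first by rewrite card_tep_varE addn_gt0 expn_gt0 orbT.
    exact: eq_leq (card_tree_value k_gt0 d c).
  have le_k : (2 ^ d.+1 <= k)%N.
    by apply: leq_trans (@trunc_logP 2 k isT k_gt0); rewrite leq_exp2l.
  apply: le_trans (Shat_ub k_gt0 (coverable_tree k_gt0 le_k)) _.
  (* The constant 2^(2^d - 1) obtained is a quarter of 2^(2^d + 1), hence at most a third of it. *)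
  rewrite natrM ler_wpM2r ?ler0n // ler_pdivlMr ?ltr0n //.
  rewrite -(natrX _ 2) -natrM ler_nat.
  rewrite -[X in (_ <= 2 ^ (X + 1))%N](@subnK 1) ?expn_gt0 //.
  by rewrite -addnA expnD leq_mul2l orbT.
split=> // k_ge4; set h := trunc_log 2 (trunc_log 2 k).
have log_ge2 : (2 <= trunc_log 2 k)%N.
  by rewrite -[2%N in X in (X <= _)%N]/(trunc_log 2 4) leq_trunc_log.
have h_gt0 : (1 <= h)%N by rewrite -[1%N]/(trunc_log 2 2) leq_trunc_log.
have le_h : (2 ^ h <= trunc_log 2 k)%N.
  by apply: trunc_logP => //; apply: leq_trans log_ge2.
have [_ ub] := bounds h h_gt0 (leq_trans (ltnW (ltn_expl h (ltnSn 1))) le_h).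
apply: le_trans ub _.
rewrite mulrAC ler_pM2r ?invr_gt0 ?ltr0n // expr2 ler_pM2r ?ltr0n //.
rewrite -(natrX _ 2) ler_nat.
(* What remains is 2m <= k for m = 2^(2^(h - 1)). It follows from m^2 = 2^(2^h) <= k if m >= 2, and
   from 4 <= k otherwise. *)
have le_sq : ((2 ^ (2 ^ (h - 1))) ^ 2 <= k)%N.
  rewrite -expnM -expnSr -[(h - 1).+1]addn1 subnK //.
  by apply: leq_trans (@trunc_logP 2 k isT k_gt0); rewrite leq_exp2l.
rewrite expnD expn1; move: le_sq; move: (2 ^ _)%N => m; rewrite -mulnn; nia.
Qed.
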